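(* Let $f:\mathbb{R}^n\to\mathbb{R}$ be a weak uniform CN function with CN form $f=[g:g_1,\dots,g_r]$, and let $(\bm x^*,\bm y^* )\in X(f)$. Consider the problem $$(\mathrm{WCNP})(\bm x^*,\bm y^* ):\quad \min\ \nabla g(\bm x^*,\bm y^* )^\top \bm d+\tfrac12 \bm d^\top B(\bm x^*,\bm y^* )\bm d\quad\text{s.t. } \bm d\in T(\bm x^*,\bm y^* ).$$ If $\bm d^*$ is an optimal solution to $(\mathrm{WCNP})(\bm x^*,\bm y^* )$ such that $\nabla g(\bm x^*,\bm y^* )^\top \bm d^*+\frac12 \bm d^{*\top}B(\bm x^*,\bm y^* )\bm d^*\ge 0$, then $(\bm x^*,\bm y^* )$ is an optimal solution to (CNP) and $\bm x^*$ is an optimal solution to (CNO). Furthermore, if there is a $\bm d'$ such that $\nabla g_i(\bm x^*,\bm y^* )^\top\bm d'<0$ for $i=1,\dots,r$, then there are $\alpha_i^*\ge 0$, $i=1,\dots,r$, such that $$B(\bm x^*,\bm y^* )\bm d^*+\nabla g(\bm x^*,\bm y^* )+\sum_{i=1}^r\alpha_i^*\nabla g_i(\bm x^*,\bm y^* )=0,\qquad \alpha_i^*\nabla g_i(\bm x^*,\bm y^* )^\top\bm d^*=0,\ i=1,\dots,r. \quad(\ast)$$ Conversely, if there are $\bm d^*\in T(\bm x^*,\bm y^* )$ and $\alpha_i^*\ge0$, $i=1,\dots,r$, such that $(\ast)$ holds, then $\bm d^*$ is an optimal solution to $(\mathrm{WCNP})(\bm x^*,\bm y^* )$.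
   Context: Let $f:\mathbb{R}^n\to\mathbb{R}$ be nonconvex and let $g,g_1,\dots,g_r:\mathbb{R}^n\times\mathbb{R}^m\to\mathbb{R}$ ($r\ge1$) be convex. Put $\bm g=(g_1,\dots,g_r)^\top$ and $X(\bm g)=\{(\bm x,\bm y)\in\mathbb{R}^n\times\mathbb{R}^m: g_i(\bm x,\bm y)=0,\ i=1,\dots,r\}$. The function $f$ is a CN (convertible nonconvex) function with CN form $f=[g:g_1,\dots,g_r]$ if for each $\bm x\in\mathbb{R}^n$ there is $\bm y\in\mathbb{R}^m$ with $(\bm x,\bm y)\in X(\bm g)$ and $f(\bm x)=g(\bm x,\bm y)=\min_{(\bm x,\bm y')\in X(\bm g)}g(\bm x,\bm y')$. Put $X(f)=\{(\bm x,\bm y)\in X(\bm g): f(\bm x)=g(\bm x,\bm y)\}$. $f$ is a weak uniform CN function if moreover $g$ is weak uniform convex: for every $(\bm x,\bm y)$ there is a positive semidefinite (symmetric) matrix $B(\bm x,\bm y)$ such that $g((\bm x,\bm y)+\bm d)-g(\bm x,\bm y)\ge\nabla g(\bm x,\bm y)^\top\bm d+\frac12\bm d^\top B(\bm x,\bm y)\bm d$ for all $\bm d\in\mathbb{R}^n\times\mathbb{R}^m$; such a $B$ is fixed. Standing assumption: $g,g_1,\dots,g_r$ are twice differentiable ($f$ need not be differentiable). (CNO): $\min f(\bm x)$ s.t. $\bm x\in\mathbb{R}^n$. (CNP): $\min g(\bm x,\bm y)$ s.t. $(\bm x,\bm y)\in\mathbb{R}^n\times\mathbb{R}^m$, $g_i(\bm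 x,\bm y)=0$, $i=1,\dots,r$. ''Optimal solution'' means global minimizer. $T(\bm x,\bm y)=\{\bm d\in\mathbb{R}^n\times\mathbb{R}^m:\nabla g_i(\bm x,\bm y)^\top\bm d\le0,\ i=1,\dots,r\}$. *)

(* Defs.v *)
(* A point (x, y) of R^n x R^m is the column vector [col_mx x y : 'cV[R]_(n + m)]. *)
From HB Require Import structures.
From mathcomp Require Import all_boot all_order all_algebra.
From mathcomp Require Import all_classical all_reals all_analysis.

Set Implicit Arguments.
Unset Strict Implicit.
Unset Printing Implicit Defensive.

Import Order.TTheory GRing.Theory Num.Theory.
Import numFieldNormedType.Exports.

Local Open Scope classical_set_scope.
Local Open Scope ring_scope.

Definition dotv (R : realType) (N : nat) (u v : 'cV[R]_N) : R :=
  (u^T *m v) ord0 ord0.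

(* Column vector of partial derivatives; it is only meaningful where [h] is
   differentiable. *)
Definition grad (R : realType) (N : nat) (h : 'cV[R]_N -> R) (z : 'cV[R]_N) :
    'cV[R]_N :=
  \col_(i < N) 'D_(delta_mx i ord0) h z.

Definition twice_differentiable (R : realType) (N : nat) (h : 'cV[R]_N -> R) :
    Prop :=
  (forall z, differentiable h z) /\ (forall z, differentiable (grad h) z).

Definition convex_fun (R : realType) (N : nat) (h : 'cV[R]_N -> R) : Prop :=
  @convex_function R 'cV[R]_N [set: 'cV[R]_N] h.

Definition global_minimizer (R : realType) (T : Type) (A : set T) (h : T -> R)
    (z : T) : Prop :=
  A z /\ forall w, A w -> h z <= h w.

Definition Xg (R : realType) (n m r : nat) (gs : 'I_r -> 'cV[R]_(n + m) -> R) :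
    set 'cV[R]_(n + m) :=
  [set z | forall i, gs i z = 0].

(* f = [g : g_1, ..., g_r]; the last field says that the minimum of g over the
   fibre of X(g_1, ..., g_r) above x is attained and equals f x. *)
Record CN_form (R : realType) (n m r : nat) (f : 'cV[R]_n -> R)
    (g : 'cV[R]_(n + m) -> R) (gs : 'I_r -> 'cV[R]_(n + m) -> R) : Prop := {
  CN_nonconvex : ~ convex_fun f;
  CN_r_gt0 : (0 < r)%N;
  CN_convex : convex_fun g;
  CN_convex_constraint : forall i, convex_fun (gs i);
  CN_min : forall x : 'cV[R]_n, exists y : 'cV[R]_m,
    f x = g (col_mx x y) /\
    global_minimizer [set y' | Xg gs (col_mx x y')]
      (fun y' => g (col_mx x y')) y
}.

Definition Xf (R : realType) (n m r : nat) (f : 'cV[R]_n -> R)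
    (g : 'cV[R]_(n + m) -> R) (gs : 'I_r -> 'cV[R]_(n + m) -> R) :
    set 'cV[R]_(n + m) :=
  [set z | Xg gs z /\ f (usubmx z) = g z].

Definition psd_mx (R : realType) (N : nat) (M : 'M[R]_N) : Prop :=
  M^T = M /\ forall d : 'cV[R]_N, 0 <= dotv d (M *m d).

(* Weak uniform convexity of g, witnessed by the fixed choice B of matrices. *)
Definition weak_uniform_convex (R : realType) (N : nat) (g : 'cV[R]_N -> R)
    (B : 'cV[R]_N -> 'M[R]_N) : Prop :=
  forall z, psd_mx (B z) /\
    forall d, dotv (grad g z) d + 2^-1 * dotv d (B z *m d) <= g (z + d) - g z.

Definition weak_uniform_CN (R : realType) (n m r : nat) (f : 'cV[R]_n -> R)
    (g : 'cV[R]_(n + m) -> R) (gs : 'I_r -> 'cV[R]_(n + m) -> R)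
    (B : 'cV[R]_(n + m) -> 'M[R]_(n + m)) : Prop :=
  CN_form f g gs /\ weak_uniform_convex g B.

Definition optimal_CNO (R : realType) (n : nat) (f : 'cV[R]_n -> R)
    (x : 'cV[R]_n) : Prop :=
  global_minimizer [set: 'cV[R]_n] f x.

Definition optimal_CNP (R : realType) (n m r : nat) (g : 'cV[R]_(n + m) -> R)
    (gs : 'I_r -> 'cV[R]_(n + m) -> R) (z : 'cV[R]_(n + m)) : Prop :=
  global_minimizer (Xg gs) g z.

Definition Tcone (R : realType) (n m r : nat)
    (gs : 'I_r -> 'cV[R]_(n + m) -> R) (z : 'cV[R]_(n + m)) :
    set 'cV[R]_(n + m) :=
  [set d | forall i, dotv (grad (gs i) z) d <= 0].

Definition WCNP_obj (R : realType) (N : nat) (g : 'cV[R]_N -> R)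
    (B : 'cV[R]_N -> 'M[R]_N) (z d : 'cV[R]_N) : R :=
  dotv (grad g z) d + 2^-1 * dotv d (B z *m d).

Definition optimal_WCNP (R : realType) (n m r : nat) (g : 'cV[R]_(n + m) -> R)
    (gs : 'I_r -> 'cV[R]_(n + m) -> R) (B : 'cV[R]_(n + m) -> 'M[R]_(n + m))
    (z d : 'cV[R]_(n + m)) : Prop :=
  global_minimizer (Tcone gs z) (WCNP_obj g B z) d.

Definition WCNP_KKT (R : realType) (n m r : nat) (g : 'cV[R]_(n + m) -> R)
    (gs : 'I_r -> 'cV[R]_(n + m) -> R) (B : 'cV[R]_(n + m) -> 'M[R]_(n + m))
    (z d : 'cV[R]_(n + m)) (alpha : 'I_r -> R) : Prop :=
  B z *m d + grad g z + \sum_(i < r) alpha i *: grad (gs i) z = 0 /\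
  forall i, alpha i * dotv (grad (gs i) z) d = 0.

(* Main.v *)
Require Import Defs.
From HB Require Import structures.
From mathcomp Require Import all_boot all_order all_algebra.
From mathcomp Require Import all_classical all_reals all_analysis.
From mathcomp Require Import ring lra.
Import Order.TTheory GRing.Theory Num.Theory.
Import numFieldNormedType.Exports.
Local Open Scope classical_set_scope.
Local Open Scope ring_scope.
Set Implicit Arguments.
Unset Strict Implicit.
Unset Printing Implicit Defensive.

(** (WCNP) relaxes (CNP) for two reasons. A feasible point [w] of (CNP) gives a
feasible direction [w - z] of (WCNP) at [z], because a convex differentiable
constraint that vanishes at both points has nonpositive slope from [z]
towards [w] ([feasible_direction_Tcone]). And weak uniform convexity
says that the objective of (WCNP) at [w - z] bounds [g w - g z] from below. So
if the optimal value of (WCNP) is nonnegative, then [g w - g z] is nonnegative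
for every feasible [w] ([optimal_CNP_of_WCNP_ge0]). Each value [f x] is a value
of [g] on the feasible set, hence [f] is minimal as well ([optimal_CNO_of_CNP]).

The conditions on the multipliers come from an exact expansion of the quadratic
objective around [d], whose linear part is [c = B d + grad g] ([WCNP_objD]). The
feasible set is a cone, so at a minimizer [c] is nonnegative on the cone and
vanishes at [d] itself ([optimal_WCNP_stationary]). Farkas' lemma ([farkas])
then writes [- c] as a nonnegative combination of the constraint gradients;
pairing this with [d] gives a sum of nonpositive terms equal to 0, and this is
complementary slackness. Conversely, for [e] in the cone, the multipliers make
the linear part of the expansion at [e - d] nonnegative, and the quadratic part is
nonnegative because [B] is positive semidefinite ([KKT_optimal_WCNP]). *)

(** * The dot product *)

Lemma dotvE (R : realType) (N : nat) (u v : 'cV[R]_N) :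
  dotv u v = \sum_i u i ord0 * v i ord0.
Proof. by rewrite /dotv mxE; apply: eq_bigr => i _; rewrite mxE. Qed.

Lemma dotvC (R : realType) (N : nat) (u v : 'cV[R]_N) : dotv u v = dotv v u.
Proof. by rewrite !dotvE; apply: eq_bigr => i _; rewrite mulrC. Qed.

Lemma dotvDr (R : realType) (N : nat) (u v w : 'cV[R]_N) :
  dotv u (v + w) = dotv u v + dotv u w.
Proof. by rewrite /dotv mulmxDr mxE. Qed.

Lemma dotvZr (R : realType) (N : nat) a (u v : 'cV[R]_N) :
  dotv u (a *: v) = a * dotv u v.
Proof. by rewrite /dotv -scalemxAr mxE. Qed.

Lemma dotv0r (R : realType) (N : nat) (u : 'cV[R]_N) : dotv u 0 = 0.
Proof. by rewrite /dotv mulmx0 mxE. Qed.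

Lemma dotvNr (R : realType) (N : nat) (u v : 'cV[R]_N) :
  dotv u (- v) = - dotv u v.
Proof. by rewrite -scaleN1r dotvZr mulN1r. Qed.

Lemma dotvDl (R : realType) (N : nat) (u v w : 'cV[R]_N) :
  dotv (u + v) w = dotv u w + dotv v w.
Proof. by rewrite dotvC dotvDr !(dotvC w). Qed.

Lemma dotvZl (R : realType) (N : nat) a (u v : 'cV[R]_N) :
  dotv (a *: u) v = a * dotv u v.
Proof. by rewrite dotvC dotvZr dotvC. Qed.

Lemma dotvNl (R : realType) (N : nat) (u v : 'cV[R]_N) :
  dotv (- u) v = - dotv u v.
Proof. by rewrite dotvC dotvNr dotvC. Qed.

Lemma dotv_suml (R : realType) (N r : nat) (a : 'I_r -> 'cV[R]_N) v :
  dotv (\sum_i a i) v = \sum_i dotv (a i) v.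
Proof.
apply: (big_morph (fun u => dotv u v)) => [u w|]; first exact: dotvDl.
by rewrite dotvC dotv0r.
Qed.

Lemma dotv_mulmxr (R : realType) (N : nat) (M : 'M[R]_N) (u v : 'cV[R]_N) :
  dotv u (M *m v) = dotv (M^T *m u) v.
Proof. by rewrite /dotv trmx_mul trmxK mulmxA. Qed.

Lemma dotv_self_le0 (R : realType) (N : nat) (u : 'cV[R]_N) :
  dotv u u <= 0 -> u = 0.
Proof.
have sq_ge0 i : true -> 0 <= u i ord0 * u i ord0.
  by rewrite -expr2 sqr_ge0.
move=> u_le0; have /eqP : dotv u u = 0.
  by apply/eqP; rewrite eq_le u_le0 dotvE sumr_ge0.
rewrite dotvE psumr_eq0// => /allP u0.
apply/matrixP => i j; rewrite (ord1 j) mxE.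
by have := u0 i (mem_index_enum i); rewrite mulf_eq0 orbb => /eqP.
Qed.

(** * Farkas' lemma *)

(** Bartl's algebraic proof, by induction on the number of vectors: it needs only
the order of the field, no separation of closed cones. Either [a ord0] can be
dropped, or some [x] satisfies the other inequalities with [dotv c x > 0];
then [a ord0] is positive at [x], and the remaining functionals are restricted
to the hyperplane [dotv (a ord0) d = 0] by projecting along [x]. *)
Lemma farkas (R : realType) (N r : nat) (a : 'I_r -> 'cV[R]_N) (c : 'cV[R]_N) :
  (forall d, (forall i, dotv (a i) d <= 0) -> dotv c d <= 0) ->
  exists2 l : 'I_r -> R, forall i, 0 <= l i & c = \sum_i l i *: a i.
Proof.
elim: r a c => [|r IHr] a c c_le0.
  exists (fun=> 0) => //; rewrite big_ord0; apply/dotv_self_le0/c_le0.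
  by case.
have [c_le0'|] := pselect (forall d,
    (forall i : 'I_r, dotv (a (lift ord0 i)) d <= 0) -> dotv c d <= 0).
  have [l l_ge0 ->] := IHr _ _ c_le0'.
  exists (fun i => oapp l 0 (unlift ord0 i)) => [i|].
    by case: unliftP => [j|] _ //=.
  rewrite big_ord_recl unlift_none /= scale0r add0r.
  by apply: eq_bigr => i _; rewrite liftK.
move=> /existsNP[x /not_implyP[ax_le0 /negP]]; rewrite -ltNge => cx_gt0.
have a0x_gt0 : 0 < dotv (a ord0) x.
  rewrite ltNge; apply/negP => a0x_le0; move: cx_gt0; rewrite ltNge.
  by rewrite c_le0// => i; case: (unliftP ord0 i) => [j|] ->.
set p := dotv (a ord0) x in a0x_gt0.
have p_neq0 : p != 0 by rewrite gt_eqF.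
(* [pr u] is the functional [u] precomposed with the projection along [x] onto
   the kernel of [a ord0]. *)
pose pr (u : 'cV[R]_N) : 'cV[R]_N := u - (dotv u x / p) *: a ord0.
have prE u d : dotv (pr u) d = dotv u (d - (dotv (a ord0) d / p) *: x).
  rewrite /pr dotvDl dotvNl dotvZl dotvDr dotvNr dotvZr.
  by rewrite mulrAC [in RHS]mulrAC [dotv u x * _]mulrC.
have [|l l_ge0 prcE] := IHr (fun i => pr (a (lift ord0 i))) (pr c).
  move=> d ad_le0; rewrite prE; apply: c_le0 => i.
  case: (unliftP ord0 i) => [j|] ->; first by rewrite -prE.
  by rewrite dotvDr dotvNr dotvZr -/p divfK// subrr.
(* The coefficient of [a ord0] is forced by evaluating at [x]; it is
   nonnegative since [dotv c x > 0] while [dotv (a i) x <= 0] for the other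
   [i]. *)
pose l0 := (dotv c x - \sum_i l i * dotv (a (lift ord0 i)) x) / p.
exists (fun i => oapp l l0 (unlift ord0 i)) => [i|].
  case: unliftP => [j|] _ //=.
  apply: divr_ge0; last exact: ltW.
  rewrite subr_ge0.
  apply: le_trans (ltW cx_gt0); apply: sumr_le0 => j _.
  exact: mulr_ge0_le0.
rewrite big_ord_recl unlift_none /=.
under eq_bigr => i _ do rewrite liftK /=.
transitivity (pr c + (dotv c x / p) *: a ord0); first by rewrite subrK.
rewrite prcE /l0 mulrBl scalerBl.
have prZ k u : k *: pr u = k *: u - (k * dotv u x / p) *: a ord0.
  by rewrite /pr scalerBr scalerA mulrA.
rewrite (eq_bigr _ (fun i _ => prZ _ _)).
by rewrite sumrB -scaler_suml -mulr_suml addrAC [RHS]addrC addrA.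
Qed.

(** * Gradients of convex functions *)

Lemma derive_grad (R : realType) (N : nat) (h : 'cV[R]_N -> R) z d :
  differentiable h z -> 'D_d h z = dotv (grad h z) d.
Proof.
move=> hz; rewrite deriveE//.
rewrite [in LHS](_ : d = \sum_i d i ord0 *: delta_mx i ord0).
  rewrite linear_sum dotvE; apply: eq_bigr => i _.
  by rewrite linearZ /= mxE deriveE// mulrC.
apply/matrixP => i j; rewrite (ord1 j) summxE (bigD1 i)//= !mxE !eqxx mulr1.
by rewrite big1 ?addr0// => k ki; rewrite !mxE eq_sym (negPf ki) mulr0.
Qed.

(** The right difference quotients of [h] at [z] along [d] are at most
[h (z + d) - h z] for steps in ]0, 1], and so is their limit. *)
Lemma convex_grad_le (R : realType) (N : nat) (h : 'cV[R]_N -> R) z d :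
  convex_fun h -> differentiable h z -> dotv (grad h z) d <= h (z + d) - h z.
Proof.
move=> h_convex hz; rewrite -derive_grad// /derive.
have D_cvg : derivable h z d by exact: diff_derivable.
rewrite cvg_at_rightE//; apply: limr_le.
  by apply/cvg_ex; eexists; apply/cvg_dnbhs_at_right/D_cvg.
near=> t.
have t_gt0 : 0 < t by near: t; exact: nbhs_right_gt.
have t_le1 : t <= 1 by near: t; exact: nbhs_right_le.
have chord : h (t *: d + z) <= t * h (z + d) + (1 - t) * h z.
  have -> : t *: d + z = t *: (z + d) + (1 - t) *: z.
    by rewrite scalerDr scalerBl scale1r [RHS]addrC addrA subrK addrC.
  by apply: (h_convex (Itv01 (ltW t_gt0) t_le1)); rewrite in_setT.
rewrite /= -[_ *: _]/(_ * _) mulrC ler_pdivrMr//; lra.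
Unshelve. all: by end_near.
Qed.

(** * Optimality in the quadratic subproblem *)

(** The first-order test along a segment: for small steps the linear term beats
the quadratic one. *)
Lemma ge0_of_perturbation (R : realType) (a b : R) :
  (forall t, 0 < t -> t <= 1 -> 0 <= t * a + t ^+ 2 * b) -> 0 <= a.
Proof.
move=> ab_ge0; rewrite leNgt; apply/negP => a_lt0.
have D_gt0 : 0 < - a + `|b| + 1.
  by have := normr_ge0 b; lra.
(* This step lies in ]0, 1] and makes [t * b] smaller than [- a]. *)
have := ab_ge0 (- a / (- a + `|b| + 1)).
set t := _ / _; have t_gt0 : 0 < t by rewrite divr_gt0// oppr_gt0.
have tE : t * (- a + `|b| + 1) = - a by rewrite divfK// gt_eqF.
have b_ge0 := normr_ge0 b.
have b_le := ler_norm b.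
have t_le1 : t <= 1 by rewrite ler_pdivrMr//; lra.
move=> /(_ t_gt0 t_le1); apply/negP; rewrite -ltNge.
have -> : t * a + t ^+ 2 * b = t * (a + t * b) by ring.
rewrite pmulr_rlt0//.
have : t * b <= t * `|b| by rewrite ler_pM2l.
have : 0 < t * - a by rewrite mulr_gt0// oppr_gt0.
have : t * (- a + `|b| + 1) = t * - a + t * `|b| + t by ring.
lra.
Qed.

(** The objective is quadratic, so its second-order expansion at [d] is exact;
symmetry of [B z] merges the two cross terms into [B z *m d]. *)
Lemma WCNP_objD (R : realType) (N : nat) (g : 'cV[R]_N -> R)
    (B : 'cV[R]_N -> 'M[R]_N) (z d e : 'cV[R]_N) :
  (B z)^T = B z ->
  WCNP_obj g B z (d + e) =
  WCNP_obj g B z d + dotv (B z *m d + grad g z) e + 2^-1 * dotv e (B z *m e).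
Proof.
move=> B_sym; rewrite /WCNP_obj mulmxDr !dotvDr !dotvDl.
have -> : dotv d (B z *m e) = dotv (B z *m d) e by rewrite dotv_mulmxr B_sym.
by rewrite (dotvC e (B z *m d)); lra.
Qed.

(** Moving from [d] by [t *: e] with [e] in the cone, or by [- t *: d] with
[t <= 1], stays in the cone. The directions [d] and [- d] give the equality. *)
Lemma optimal_WCNP_stationary (R : realType) (n m r : nat)
    (g : 'cV[R]_(n + m) -> R) (gs : 'I_r -> 'cV[R]_(n + m) -> R)
    (B : 'cV[R]_(n + m) -> 'M[R]_(n + m)) (z d : 'cV[R]_(n + m)) :
  (B z)^T = B z -> optimal_WCNP g gs B z d ->
  dotv (B z *m d + grad g z) d = 0 /\
  forall e, Tcone gs z e -> 0 <= dotv (B z *m d + grad g z) e.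
Proof.
move=> B_sym [dT d_min]; set c := B z *m d + grad g z.
have stat e : (forall t, 0 < t -> t <= 1 -> Tcone gs z (d + t *: e)) ->
    0 <= dotv c e.
  move=> eT; apply: (@ge0_of_perturbation _ _ (2^-1 * dotv e (B z *m e))).
  move=> t t_gt0 t_le1; have := d_min _ (eT t t_gt0 t_le1).
  rewrite WCNP_objD// -/c -scalemxAr !dotvZr dotvZl; lra.
have c_ge0 e : Tcone gs z e -> 0 <= dotv c e.
  move=> eT; apply: stat => t t_gt0 _ i; rewrite dotvDr dotvZr.
  have := mulr_ge0_le0 (ltW t_gt0) (eT i); have := dT i; lra.
split=> //; apply/eqP; rewrite eq_le c_ge0// andbT -oppr_ge0 -dotvNr.
apply: stat => t t_gt0 t_le1 i; rewrite dotvDr dotvZr dotvNr.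
have := dT i; set s := dotv _ _ => s_le0.
have -> : s + t * - s = (1 - t) * s by ring.
by rewrite mulr_ge0_le0// subr_ge0.
Qed.

(** Farkas' lemma applied to [- c], where [c] is the gradient of the objective at
[d]. Complementary slackness follows from [dotv c d = 0], which is minus the sum
of the terms [alpha i * dotv (grad (gs i) z) d], all of the same sign. *)
Lemma optimal_WCNP_KKT (R : realType) (n m r : nat)
    (g : 'cV[R]_(n + m) -> R) (gs : 'I_r -> 'cV[R]_(n + m) -> R)
    (B : 'cV[R]_(n + m) -> 'M[R]_(n + m)) (z d : 'cV[R]_(n + m)) :
  (B z)^T = B z -> optimal_WCNP g gs B z d ->
  exists alpha : 'I_r -> R,
    (forall i, 0 <= alpha i) /\ WCNP_KKT g gs B z d alpha.
Proof.
move=> B_sym d_opt; have [cd_eq0 c_ge0] := optimal_WCNP_stationary B_sym d_opt.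
have [|l l_ge0 cE] := @farkas _ _ _ (fun i => grad (gs i) z)
    (- (B z *m d + grad g z)).
  by move=> e eT; rewrite dotvNl oppr_le0; exact: c_ge0.
exists l; split=> //; split; first by rewrite -cE subrr.
have ld_ge0 i : true -> 0 <= - (l i * dotv (grad (gs i) z) d).
  by move=> _; rewrite oppr_ge0 mulr_ge0_le0//; exact: d_opt.1.
have : \sum_i - (l i * dotv (grad (gs i) z) d) = 0.
  rewrite sumrN -[in RHS]cd_eq0 -[in RHS](opprK (_ + grad g z)) cE dotvNl.
  by rewrite dotv_suml; congr (- _); apply: eq_bigr => i _; rewrite dotvZl.
move=> /eqP; rewrite psumr_eq0// => /allP ld_eq0 i.
by have := ld_eq0 i (mem_index_enum i); rewrite oppr_eq0 => /eqP.
Qed.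

(** By complementary slackness the linear part of the expansion at [d], taken at
[e - d], is minus the sum of the [alpha i * dotv (grad (gs i) z) e], and these
are nonpositive. *)
Lemma KKT_optimal_WCNP (R : realType) (n m r : nat)
    (g : 'cV[R]_(n + m) -> R) (gs : 'I_r -> 'cV[R]_(n + m) -> R)
    (B : 'cV[R]_(n + m) -> 'M[R]_(n + m)) (z d : 'cV[R]_(n + m))
    (alpha : 'I_r -> R) :
  psd_mx (B z) -> Tcone gs z d -> (forall i, 0 <= alpha i) ->
  WCNP_KKT g gs B z d alpha -> optimal_WCNP g gs B z d.
Proof.
move=> [B_sym B_psd] dT alpha_ge0 [c_eq0 slack]; split=> // e eT.
rewrite -[e](subrK d) [e - d + d]addrC WCNP_objD// -addrA lerDl.
rewrite addr_ge0//; last first.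
  by rewrite mulr_ge0// B_psd.
move/eqP: c_eq0; rewrite addr_eq0 => /eqP ->.
rewrite dotvNl dotv_suml oppr_ge0 sumr_le0// => i _.
by rewrite dotvZl dotvDr dotvNr mulrBr slack subr0 mulr_ge0_le0//; exact: eT.
Qed.

(** * From the subproblem to the original problems *)

Lemma feasible_direction_Tcone (R : realType) (n m r : nat)
    (gs : 'I_r -> 'cV[R]_(n + m) -> R) (z w : 'cV[R]_(n + m)) :
  (forall i, convex_fun (gs i)) -> (forall i, differentiable (gs i) z) ->
  Xg gs z -> Xg gs w -> Tcone gs z (w - z).
Proof.
move=> gs_convex gs_diff zX wX i.
apply: le_trans (convex_grad_le _ (gs_convex i) (gs_diff i)) _.
by rewrite [z + _]addrC subrK zX wX subrr.
Qed.

Lemma optimal_CNP_of_WCNP_ge0 (R : realType) (n m r : nat)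
    (g : 'cV[R]_(n + m) -> R) (gs : 'I_r -> 'cV[R]_(n + m) -> R)
    (B : 'cV[R]_(n + m) -> 'M[R]_(n + m)) (z d : 'cV[R]_(n + m)) :
  weak_uniform_convex g B ->
  (forall i, convex_fun (gs i)) -> (forall i, differentiable (gs i) z) ->
  Xg gs z -> optimal_WCNP g gs B z d -> 0 <= WCNP_obj g B z d ->
  optimal_CNP g gs z.
Proof.
move=> g_wuc gs_convex gs_diff zX [_ d_min] d_ge0; split=> // w wX.
rewrite -subr_ge0; apply: le_trans d_ge0 _.
apply: le_trans (d_min _ (feasible_direction_Tcone _ _ zX wX)) _ => //.
by have := (g_wuc z).2 (w - z); rewrite [z + _]addrC subrK.
Qed.

(** The lift of [x] provided by the CN form is feasible for (CNP) and has value
[f x] under [g], so minimality of [g] transfers to [f]. *)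
Lemma optimal_CNO_of_CNP (R : realType) (n m r : nat) (f : 'cV[R]_n -> R)
    (g : 'cV[R]_(n + m) -> R) (gs : 'I_r -> 'cV[R]_(n + m) -> R)
    (z : 'cV[R]_(n + m)) :
  CN_form f g gs -> Xf f g gs z -> optimal_CNP g gs z ->
  optimal_CNO f (usubmx z).
Proof.
move=> f_CN [_ fzE] [_ z_min]; split=> // x _.
have [y [-> [xyX _]]] := CN_min f_CN x.
by rewrite fzE; exact: z_min.
Qed.

Theorem theorem3p1 (R : realType) (n m r : nat)
    (f : 'cV[R]_n -> R) (g : 'cV[R]_(n + m) -> R)
    (gs : 'I_r -> 'cV[R]_(n + m) -> R)
    (B : 'cV[R]_(n + m) -> 'M[R]_(n + m))
    (g_diff : twice_differentiable g)
    (gs_diff : forall i, twice_differentiable (gs i))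
    (f_CN : weak_uniform_CN f g gs B)
    (xs : 'cV[R]_n) (ys : 'cV[R]_m)
    (xys_Xf : Xf f g gs (col_mx xs ys)) :
  (forall ds : 'cV[R]_(n + m),
     optimal_WCNP g gs B (col_mx xs ys) ds ->
     0 <= WCNP_obj g B (col_mx xs ys) ds ->
     (optimal_CNP g gs (col_mx xs ys) /\ optimal_CNO f xs) /\
     ((exists d' : 'cV[R]_(n + m),
         forall i, dotv (grad (gs i) (col_mx xs ys)) d' < 0) ->
      exists alpha : 'I_r -> R,
        (forall i, 0 <= alpha i) /\
        WCNP_KKT g gs B (col_mx xs ys) ds alpha)) /\
  (forall ds : 'cV[R]_(n + m),
     Tcone gs (col_mx xs ys) ds ->
     (exists alpha : 'I_r -> R,
        (forall i, 0 <= alpha i) /\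
        WCNP_KKT g gs B (col_mx xs ys) ds alpha) ->
     optimal_WCNP g gs B (col_mx xs ys) ds).
Proof.
have [f_form g_wuc] := f_CN; have B_psd := (g_wuc (col_mx xs ys)).1.
have gs_convex := CN_convex_constraint f_form.
have gs_diff1 i := (gs_diff i).1 (col_mx xs ys).
split=> [ds ds_opt ds_ge0|ds dsT [alpha [alpha_ge0 kkt]]].
  have z_opt := optimal_CNP_of_WCNP_ge0 g_wuc gs_convex gs_diff1 xys_Xf.1
    ds_opt ds_ge0.
  split=> [|_]; last exact: optimal_WCNP_KKT B_psd.1 ds_opt.
  split=> //.
  by have := optimal_CNO_of_CNP f_form xys_Xf z_opt; rewrite col_mxKu.
exact: KKT_optimal_WCNP B_psd dsT alpha_ge0 kkt.
Qed.
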